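(* Let $\Delta, D, r$ be integers with $r \geq 0$ and $\Delta \geq D \geq r+2$. Then the automorphism group of the cycle prefix digraph $\Gamma_\Delta(D,-r)$ is isomorphic to the symmetric group $S_{\Delta+1}$ on the underlying set $\{1,2,\ldots,\Delta+1\}$.
   Context: The digraph $\Gamma_\Delta(D,-r)$: its vertices are the sequences $x_1x_2\ldots x_D$ of $D$ pairwise distinct elements of $\{1,2,\ldots,\Delta+1\}$. There is an arc from the vertex $x_1x_2\ldots x_D$ to each of the following vertices, and to no others: (rotations) $R_k(x_1x_2\ldots x_D) = x_k x_1 \ldots x_{k-1} x_{k+1} \ldots x_D$ for each $k$ with $r+2 \leq k \leq D$; (shifts) $S_m(x_1x_2\ldots x_D) = m x_1 x_2 \ldots x_{D-1}$ for each $m \in \{1,\ldots,\Delta+1\} \setminus \{x_1,\ldots,x_D\}$. An automorphism of a digraph $G=(V,E)$ is a permutation $\pi$ of $V$ such that $(u,v)\in E$ if and only if $(\pi(u),\pi(v))\in E$; the automorphisms form a group under composition, the automorphism group of $G$. *)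

(* Defs.v *)
From HB Require Import structures.
From mathcomp Require Import all_boot all_fingroup.

Set Implicit Arguments.
Unset Strict Implicit.
Unset Printing Implicit Defensive.

Section DigraphAut.
Variables (V : finType) (arc : rel V).

Definition digraph_aut : {set {perm V}} :=
  [set s : {perm V} | [forall u, forall v, arc u v == arc (s u) (s v)]].

Lemma digraph_autP (s : {perm V}) :
  reflect (forall u v, arc u v = arc (s u) (s v)) (s \in digraph_aut).
Proof.
rewrite inE; apply: (iffP forallP) => [h u v | h u].
  by have /forallP/(_ v)/eqP := h u.
by apply/forallP=> v; apply/eqP/h.
Qed.

Lemma digraph_aut_group_set : group_set digraph_aut.
Proof.
apply/group_setP; split; first by apply/digraph_autP => u v; rewrite !perm1.
move=> s t /digraph_autP hs /digraph_autP ht.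
by apply/digraph_autP => u v; rewrite hs ht !permM.
Qed.

Canonical digraph_aut_group := Group digraph_aut_group_set.

End DigraphAut.

(* The alphabet {1, ..., Delta+1} is encoded as 'I_Delta.+1, i.e. the letters
   are shifted to 0, ..., Delta. *)
Definition cp_vertex (Delta D : nat) : Type :=
  {x : D.-tuple 'I_Delta.+1 | uniq x}.
HB.instance Definition _ (Delta D : nat) := SubFinite.on (cp_vertex Delta D).

(* x_k x_1 ... x_{k-1} x_{k+1} ... x_D with k counted from 1, so that x_k is
   the item of index k.-1; the default value ord0 is never reached for
   1 <= k <= size x. *)
Definition cp_rotation (Delta k : nat) (x : seq 'I_Delta.+1) :
    seq 'I_Delta.+1 :=
  nth ord0 x k.-1 :: take k.-1 x ++ drop k x.

Definition cp_shift (Delta : nat) (m : 'I_Delta.+1) (x : seq 'I_Delta.+1) :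
    seq 'I_Delta.+1 :=
  m :: take (size x).-1 x.

Definition cp_arc (Delta D r : nat) : rel (cp_vertex Delta D) := fun x y =>
  [exists k : 'I_D.+1,
      (r.+2 <= k) && (val y == cp_rotation k (val x) :> seq _)] ||
  [exists m : 'I_Delta.+1,
      (m \notin val x) && (val y == cp_shift m (val x) :> seq _)].

Arguments cp_arc : clear implicits.

(* Main.v *)
(* Write an arc as x -> y with y obtained from x by putting the letter m in
   front, and let t be the index of m in x (t = k - 1 for R_k, t = D for a
   shift).  Along an arc the index of a letter grows by at most one, so a walk
   from y back to x has length at least t; for a rotation t is attained, by
   iterating it.  Hence an automorphism p preserves t: it commutes with R_D and
   maps shifts to shifts.  It follows that p preserves the relation "same first
   D-1 letters" and, conjugating by R_D, that the first letter of p x is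
   unaffected when one letter of x other than the first is changed.  As
   Delta + 1 > D there is always a spare letter, so such changes connect any two
   vertices with the same first letter.  Thus the first letter of p x is a
   function of the first letter of x, and by rotation p acts letterwise. *)
Require Import Defs.
From HB Require Import structures.
From mathcomp Require Import all_boot all_fingroup zify.

Set Implicit Arguments.
Unset Strict Implicit.
Unset Printing Implicit Defensive.

Lemma index_take_le (T : eqType) (m : T) n s : index m (take n s) <= index m s.
Proof.
rewrite -{2}(cat_take_drop n s) index_cat; case: ifP => // _.
exact: leq_trans (index_size _ _) (leq_addr _ _).
Qed.

Lemma index_rem_le (T : eqType) (a m : T) s :
  a != m -> index m (rem a s) <= index m s.
Proof.
move=> ne_am; elim: s => //= b s IHs.
case: (eqVneq b a) => [-> | _] /=; first by rewrite (negPf ne_am).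
by case: eqP.
Qed.

Section CyclePrefix.

Variables (Delta D r : nat).
Hypotheses (hD : (D <= Delta)%N) (hr : (r.+2 <= D)%N).
Local Notation letter := 'I_Delta.+1.
Local Notation vertex := (cp_vertex Delta D).
Local Notation arc := (cp_arc Delta D r).

(** * Vertices as words with distinct letters *)

Definition word (x : vertex) : seq letter := val (val x).

Lemma size_word x : size (word x) = D.
Proof. exact: size_tuple. Qed.

Lemma uniq_word x : uniq (word x).
Proof. exact: (valP x). Qed.

Lemma word_inj : injective word.
Proof. by move=> x y exy; do 2!apply: val_inj. Qed.

Lemma word_ex s : size s = D -> uniq s -> {x : vertex | word x = s}.
Proof.
move=> /eqP ss us.
by exists (exist (fun t : D.-tuple letter => uniq t) (Tuple ss) us).
Qed.

Lemma word_rot_ex j x : {y | word y = rot j (word x)}.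
Proof.
by apply: word_ex; rewrite ?size_rot ?size_word ?rot_uniq ?uniq_word.
Qed.

Lemma word_set_nth x k c : k < D -> c \notin word x ->
  {y | word y = set_nth ord0 (word x) k c}.
Proof.
move=> lt_kD c'x; have sx := size_word x.
apply: word_ex; first by rewrite size_set_nth sx; apply/maxn_idPr.
rewrite set_nthE sx lt_kD -cat1s uniq_catCA cat1s /=.
have su : subseq (take k (word x) ++ drop k.+1 (word x)) (word x).
  rewrite -{3}(cat_take_drop k (word x)) cat_subseq //.
  rewrite (drop_nth ord0 (n := k)) ?sx //.
  exact: subseq_cons.
rewrite (subseq_uniq su (uniq_word x)) andbT.
by apply: contra c'x => /(mem_subseq su).
Qed.

Lemma fresh_letter x : exists c, c \notin word x.
Proof.
apply/existsP; apply: contraT; rewrite negb_exists => /forallP all_x.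
have : size (enum letter) <= size (word x).
  by apply: uniq_leq_size (enum_uniq _) _ => c _; rewrite -[_ \in _]negbK.
by rewrite size_enum_ord size_word => /leq_trans/(_ hD); rewrite ltnn.
Qed.

Lemma word_cat_ex s : uniq s -> size s <= D -> exists x t, word x = s ++ t.
Proof.
move=> us le_sD.
have [||x ex] := @word_ex (take D (s ++ [seq c <- enum letter | c \notin s])).
- rewrite size_takel //.
  have : size (enum letter) <= size (s ++ [seq c <- enum letter | c \notin s]).
    apply: uniq_leq_size (enum_uniq _) _ => c _.
    by rewrite mem_cat mem_filter mem_enum andbT orbN.
  by rewrite size_enum_ord; lia.
- rewrite take_uniq // cat_uniq us filter_uniq ?enum_uniq // andbT.
  by apply/hasPn => c; rewrite mem_filter => /andP[].
exists x, (take (D - size s) [seq c <- enum letter | c \notin s]).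
by rewrite ex take_cat ltnNge le_sD.
Qed.

(* Rotations and shifts in one formula: [R_k] is [cp_move x_k] and [S_m] is
   [cp_move m]; in the latter case [rem m x = x] and [index m x = D]. *)
Definition cp_move (m : letter) (s : seq letter) := m :: take D.-1 (rem m s).

(** Indices start at 0, so the bound r + 2 <= k for [R_k] becomes r < k - 1. The letter of a shift
    has index [D], which exceeds [r], so the same bound covers both kinds of arcs. *)
Lemma cp_arcP x y :
  reflect (exists2 m, r < index m (word x) & word y = cp_move m (word x))
          (arc x y).
Proof.
have sx := size_word x; have ux := uniq_word x.
apply: (iffP orP) => [[] | [m lt_r_m ym]].
- case/existsP=> k /andP[le_r_k /eqP ey].
  have lt_k : k.-1 < size (word x) by have := ltn_ord k; lia.
  exists (nth ord0 (word x) k.-1); first by rewrite index_uniq //; lia.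
  rewrite [word y]ey /cp_rotation -/(word x) /cp_move remE index_uniq //.
  rewrite prednK; last by lia.
  rewrite [take D.-1 _]take_oversize // size_cat size_drop size_take_min.
  by rewrite sx; have := ltn_ord k; lia.
- case/existsP=> m /andP[m'x /eqP ey]; exists m.
    by rewrite memNindex // sx; lia.
  by rewrite [word y]ey /cp_shift -/(word x) /cp_move rem_id // sx.
case: (boolP (m \in word x)) => mx; [left | right]; apply/existsP.
  have lt_m : index m (word x) < D by rewrite -sx index_mem.
  exists (Ordinal (lt_m : (index m (word x)).+1 < D.+1)).
  rewrite /= ltnS lt_r_m.
  apply/eqP; rewrite [LHS]ym /cp_rotation /cp_move /= -/(word x) nth_index //.
  rewrite [take D.-1 _]take_oversize remE // size_cat.
  by rewrite size_drop size_take_min sx; lia.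
exists m; rewrite mx /=; apply/eqP.
by rewrite [LHS]ym /cp_move rem_id // /cp_shift -/(word x) sx.
Qed.

(** * Walks and the index of the moved letter *)

Fixpoint walk n x y : Prop :=
  if n is n'.+1 then exists2 z, arc x z & walk n' z y else x = y.

(** An arc sends its own letter to index 0 and pushes any other letter at most one place to the
    right; a letter that drops out goes from index D - 1 to [D]. *)
Lemma walk_index n x y m :
  walk n x y -> index m (word y) <= index m (word x) + n.
Proof.
elim: n x => [|n IHn] x /=; first by move->; rewrite addn0.
case=> z /cp_arcP[a _ ez] /IHn /leq_trans -> //.
rewrite addnS -addSn leq_add2r ez /cp_move /=.
case: eqP => //= /eqP ne_am; rewrite ltnS.
exact: leq_trans (index_take_le _ _ _) (index_rem_le _ ne_am).
Qed.

Lemma rotation_arc x y u v m :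
  word x = rcons u m ++ v -> word y = m :: u ++ v -> r < size u -> arc x y.
Proof.
move=> ex ey lt_ru; have ux := uniq_word x; have sx := size_word x.
have m'u : m \notin u.
  by move: ux; rewrite ex cat_uniq rcons_uniq => /andP[/andP[]].
have im : index m (word x) = size u.
  by rewrite ex cat_rcons index_cat (negPf m'u) /= eqxx addn0.
apply/cp_arcP; exists m; first by rewrite im.
have er : rem m (word x) = u ++ v.
  rewrite remE im {2}ex drop_size_cat ?size_rcons //.
  by rewrite ex cat_rcons take_size_cat.
rewrite ey /cp_move er take_oversize //.
by move: sx; rewrite ex cat_rcons !size_cat /=; lia.
Qed.

(** Each arc brings the last letter of the rotated block to its front, which undoes one step of
    [rot]. *)
Lemma rotation_walk x y u v j :
    word x = rot j u ++ v -> word y = u ++ v -> r.+1 < size u -> j <= size u ->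
  walk j x y.
Proof.
elim: j x => [|j IHj] x ex ey lt_ru le_ju /=.
  by apply: word_inj; rewrite ex ey rot0.
have su : size (rot j u) = size u by rewrite size_rot.
have uz : uniq (rot j u ++ v).
  move: (uniq_word y); rewrite ey -(@perm_uniq _ (rot j u ++ v)) //.
  by rewrite perm_cat2r perm_rot.
have [|z ez] := word_ex _ uz.
  by rewrite size_cat su -(size_word y) ey size_cat.
exists z; last exact: IHj ez ey lt_ru (ltnW le_ju).
move: ex ez; rewrite rotS //; case: (rot j u) su => [|m w] /= sw.
  by rewrite -sw in lt_ru.
rewrite rot1_cons => ex ez; apply: rotation_arc ex ez _; lia.
Qed.

(** The invariant that automorphisms will preserve. It is determined by [x] and [y], since [m] is
    the head of [word y]; t = D means a shift. *)
Definition arc_index t x y :=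
  exists2 m, index m (word x) = t & word y = cp_move m (word x).

(** The arc cyclically rotates the first t + 1 letters, so [t] more rotations of the same block lead
    back to [x]. *)
Lemma arc_index_walk t x y : arc_index t x y -> arc x y -> t < D -> walk t y x.
Proof.
move=> [m im ey] /cp_arcP[m' lt_r ey'] lt_tD.
have ? : m = m' by move: ey; rewrite ey' => -[]. subst m'.
rewrite im in lt_r.
have lt_t : t < size (word x) by rewrite size_word.
have mx : m \in word x by rewrite -index_mem im.
pose u := take t (word x); pose v := drop t.+1 (word x).
have su : size u = t by rewrite size_take lt_t.
have ex : word x = rcons u m ++ v.
  rewrite cat_rcons -[LHS](cat_take_drop t); congr (_ ++ _).
  by rewrite (drop_nth m) // -{1}im nth_index.
apply: rotation_walk ex _ _; rewrite ?size_rcons ?su //.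
rewrite ey /cp_move remE im -/u -/v -su -cats1 rot_size_cat /=; congr (_ :: _).
by rewrite take_oversize // size_cat su size_drop size_word; lia.
Qed.

Lemma walk_arc_index n t x y : arc_index t x y -> walk n y x -> t <= n.
Proof. by case=> m <- ey /(walk_index m); rewrite ey /= eqxx. Qed.

Lemma aut_arcE (p : {perm vertex}) x y :
  p \in digraph_aut arc -> arc (p x) (p y) = arc x y.
Proof. by move/digraph_autP/(_ x y). Qed.

Lemma aut_walk (p : {perm vertex}) n x y :
  p \in digraph_aut arc -> walk n x y -> walk n (p x) (p y).
Proof.
move=> p_aut; elim: n x => [|n IHn] x /=; first by move->.
by case=> z xz /IHn zy; exists (p z); rewrite ?aut_arcE.
Qed.

(** For t < D, the image of the return walk of length [t] bounds [t']; otherwise the bound is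
    trivial, as no index exceeds [D]. *)
Lemma aut_arc_index_le (p : {perm vertex}) t t' x y :
    p \in digraph_aut arc -> arc x y -> arc_index t x y ->
  arc_index t' (p x) (p y) -> t' <= t.
Proof.
move=> p_aut xy xyt xyt'; have [lt_tD | le_Dt] := ltnP t D.
  exact: walk_arc_index xyt' (aut_walk p_aut (arc_index_walk xyt xy lt_tD)).
case: xyt' => m <- _; apply: leq_trans (index_size _ _) _.
by rewrite size_word.
Qed.

Lemma arc_indexP x y : arc x y -> exists t, arc_index t x y.
Proof. by case/cp_arcP=> m _ ey; exists (index m (word x)), m. Qed.

(** * Rigidity of a fixed automorphism *)

Section Automorphism.

Variable p : {perm vertex}.
Hypothesis p_aut : p \in digraph_aut arc.

Lemma aut_arc_index t x y :
  arc x y -> arc_index t x y -> arc_index t (p x) (p y).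
Proof.
move=> xy xyt; have [|t' xyt'] := @arc_indexP (p x) (p y).
  by rewrite aut_arcE.
suff -> : t = t' by [].
apply/eqP; rewrite eqn_leq (aut_arc_index_le p_aut xy xyt xyt') andbT.
(* The reverse inequality is the same bound for the inverse of [p]. *)
have p'_aut : p^-1%g \in digraph_aut arc by rewrite groupV.
by apply: (aut_arc_index_le p'_aut _ xyt'); rewrite ?aut_arcE ?permK.
Qed.

(** The arc from [x] to [y] is [R_D], of index D - 1. The image arc has the same index, so it moves
    the last letter and is [R_D] too. *)
Lemma aut_rot1 x y : word x = rot 1 (word y) -> word (p x) = rot 1 (word (p y)).
Proof.
case ey: (word y) => [|m w] ex.
  by move: (size_word y); rewrite ey /=; lia.
have sw : (size w).+1 = D by rewrite -(size_word y) ey.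
rewrite rot1_cons in ex.
have m'w : m \notin w by move: (uniq_word y); rewrite ey => /andP[].
have xy : arc x y.
  by apply: (@rotation_arc _ _ w [::] m); rewrite ?cats0 // -ltnS sw.
have im : index m (word x) = D.-1.
  by rewrite ex -cats1 index_cat (negPf m'w) /= eqxx addn0 -sw.
have xyt : arc_index D.-1 x y.
  exists m => //; have er : rem m (word x) = w.
    rewrite remE im -sw ex -cats1 take_size_cat //=.
    by rewrite drop_oversize ?cats0 // size_cat addn1.
  by rewrite ey /cp_move er -sw /= take_size.
have [a ia ->] := aut_arc_index xy xyt.
have sx := size_word (p x).
rewrite /cp_move rot1_cons remE ia prednK; last by lia.
rewrite (@drop_oversize _ D) ?sx // cats0.
rewrite [X in rcons X]take_oversize ?size_take_min ?geq_minl // -cats1.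
rewrite -[LHS](cat_take_drop D.-1); congr (_ ++ _).
have lt_D : D.-1 < size (word (p x)) by rewrite sx; lia.
rewrite (drop_nth a) // -[X in nth _ _ X]ia nth_index -?index_mem ?ia //.
by rewrite drop_oversize // sx; lia.
Qed.

Lemma aut_rot j x y :
  word x = rot j (word y) -> word (p x) = rot j (word (p y)).
Proof.
have [le_jD | lt_Dj] := leqP j D; last first.
  rewrite !rot_oversize ?size_word ?(ltnW lt_Dj) //.
  by move=> /word_inj ->.
elim: j le_jD x => [|j IHj] lt_jD x.
  by rewrite !rot0 => /word_inj ->.
rewrite (rotS (s := word y)) ?(rotS (s := word (p y))) ?size_word // => ex.
have [z ez] := word_rot_ex j y.
by rewrite -(IHj (ltnW lt_jD) z ez); apply: aut_rot1; rewrite ex ez.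
Qed.

(* If [x] and [x'] differ only in their last letter, the rotation [R_D x] is
   also a shift of [x'], so their images keep a common (D-1)-prefix. *)
Lemma aut_prefix x y s a b :
    word x = rcons s a -> word y = rcons s b ->
  take D.-1 (word (p x)) = take D.-1 (word (p y)).
Proof.
move=> ex ey; have [eab | ne_ab] := eqVneq a b.
  by congr (take _ (word (p _))); apply: word_inj; rewrite ex ey eab.
have ux := uniq_word x; have sx := size_word x.
have ss : (size s).+1 = D by rewrite -sx ex size_rcons.
have a's : a \notin s by move: ux; rewrite ex rcons_uniq => /andP[].
have a'y : a \notin word y by rewrite ey mem_rcons in_cons negb_or ne_ab.
have [|z ez] := @word_ex (a :: s) ss.
  by move: ux; rewrite ex rcons_uniq.
have yzt : arc_index D y z.
  exists a; first by rewrite memNindex ?size_word.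
  by rewrite /cp_move rem_id // ey ez -ss /= -cats1 take_size_cat.
have yz : arc y z.
  by case: yzt => m im em; apply/cp_arcP; exists m; rewrite ?im //; lia.
have epx : word (p x) = rot 1 (word (p z)).
  by apply: aut_rot1; rewrite ex ez rot1_cons.
have [m im em] := aut_arc_index yz yzt.
have m'y : m \notin word (p y) by rewrite -index_mem im size_word ltnn.
rewrite epx em /cp_move rem_id // rot1_cons -cats1 take_size_cat //.
by rewrite size_take size_word; case: ltnP; lia.
Qed.

(** Rotating by [k] brings the changed letter to the end, where [aut_prefix] applies; [aut_rot]
    carries the result back. *)
Lemma aut_head_indep x y c u v a b :
    word x = c :: u ++ a :: v -> word y = c :: u ++ b :: v ->
  head ord0 (word (p x)) = head ord0 (word (p y)).
Proof.
move=> ex ey; set k := (size u).+2.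
have sx : k + size v = D by rewrite -(size_word x) ex /= size_cat /=; lia.
have rot_k w d :
  word w = c :: u ++ d :: v -> rot k (word w) = rcons (v ++ c :: u) d.
  move=> ->; rewrite -cat_rcons -cat_cons -rcons_cons rcons_cat.
  by rewrite -[RHS]rot_size_cat size_rcons.
have [x' ex'] := word_rot_ex k x; have [y' ey'] := word_rot_ex k y.
have := aut_prefix (etrans ex' (rot_k _ _ ex)) (etrans ey' (rot_k _ _ ey)).
rewrite (aut_rot ex') (aut_rot ey').
(* The rotation puts the first letter at index D - k = size v, below D - 1 because k >= 2, so it
   survives the truncation. *)
have nth_head w :
  nth ord0 (take D.-1 (rot k (word w))) (size v) = head ord0 (word w).
  rewrite nth_take; last by lia.
  rewrite /rot nth_cat size_drop size_word ifN; last by lia.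
  by rewrite (_ : size v - _ = 0); [rewrite nth_take ?nth0 | lia].
by move=> e; rewrite -!nth_head e.
Qed.

Lemma aut_head_set_nth x y k c :
    0 < k < D -> word y = set_nth ord0 (word x) k c ->
  head ord0 (word (p x)) = head ord0 (word (p y)).
Proof.
rewrite set_nthE size_word => /andP[k0 lt_kD]; rewrite lt_kD => ey.
case ex: (word x) (size_word x) ey => [|a s] /= ss; first by lia.
case: k => [|k] // in k0 lt_kD *; move=> /= ey.
apply: aut_head_indep ey; rewrite ex; congr (_ :: _).
rewrite -[LHS](cat_take_drop k) (drop_nth ord0) //; lia.
Qed.

(** One step of turning [x] into [y] from left to right by single-letter changes, none of which
    touches index 0. *)
Lemma aut_head_extend x y k :
    0 < k < D -> {in gtn k, nth ord0 (word x) =1 nth ord0 (word y)} ->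
  exists2 z, head ord0 (word (p x)) = head ord0 (word (p z)) &
             {in gtn k.+1, nth ord0 (word z) =1 nth ord0 (word y)}.
Proof.
move=> k_in eq_xy; have /andP[k_gt0 lt_kD] := k_in.
pose b := nth ord0 (word y) k.
have fresh w : b \notin word w ->
    {in gtn k, nth ord0 (word w) =1 nth ord0 (word y)} ->
  exists2 z, head ord0 (word (p w)) = head ord0 (word (p z)) &
             {in gtn k.+1, nth ord0 (word z) =1 nth ord0 (word y)}.
  move=> b'w eq_wy; have [z ez] := word_set_nth lt_kD b'w.
  exists z; first exact: aut_head_set_nth k_in ez.
  move=> i; rewrite inE ltnS ez nth_set_nth /= => le_ik.
  case: eqVneq => [-> // | ne_ik]; apply: eq_wy.
  by rewrite inE ltn_neqAle ne_ik.
have [bx | /fresh] := boolP (b \in word x); last exact.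
pose j := index b (word x).
have lt_jD : j < D by rewrite -(size_word x) index_mem.
have xj : nth ord0 (word x) j = b by rewrite nth_index.
have le_kj : k <= j.
  rewrite leqNgt; apply/negP => lt_jk; move: xj; rewrite eq_xy // => /eqP.
  by rewrite nth_uniq ?size_word ?uniq_word // (ltn_eqF lt_jk).
have [eq_kj | ne_kj] := eqVneq k j.
  exists x => // i; rewrite inE ltnS leq_eqVlt => /predU1P[-> | /eq_xy //].
  by rewrite {1}eq_kj xj.
(* The wanted letter [b] sits further right, at j > k: overwriting it there by a spare letter makes
   [b] available for position [k]. *)
have [c c'x] := fresh_letter x; have [w ew] := word_set_nth lt_jD c'x.
have j_in : 0 < j < D by rewrite lt_jD (leq_trans k_gt0).
rewrite (aut_head_set_nth j_in ew); apply: fresh.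
  apply: contra c'x => /(nthP ord0)[i]; rewrite size_word => lt_iD.
  rewrite ew nth_set_nth /=; case: eqVneq => [_ -> // | ne_ij xi].
  case/eqP: ne_ij; apply/eqP.
  by rewrite -(nth_uniq ord0 _ _ (uniq_word x)) ?size_word // xi xj.
move=> i lt_ik; rewrite ew nth_set_nth /= ifN ?eq_xy // ltn_eqF //.
exact: leq_trans lt_ik le_kj.
Qed.

Lemma aut_head x y : head ord0 (word x) = head ord0 (word y) ->
  head ord0 (word (p x)) = head ord0 (word (p y)).
Proof.
move=> eq_hd.
(* Here [k] counts the leading positions that agree and [n] those still to be matched. *)
suff agree n k w : k + n = D -> 0 < k ->
    {in gtn k, nth ord0 (word w) =1 nth ord0 (word y)} ->
  head ord0 (word (p w)) = head ord0 (word (p y)).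
  apply: (agree D.-1 1) => //; first by lia.
  by move=> i; rewrite inE ltnS leqn0 => /eqP->; rewrite !nth0.
elim: n k w => [|n IHn] k w.
  rewrite addn0 => -> _ eq_wy; congr (head _ (word (p _))); apply: word_inj.
  by apply: (@eq_from_nth _ ord0); rewrite !size_word // => i; apply: eq_wy.
move=> ekn k_gt0 /aut_head_extend[|z -> eq_zy]; first by lia.
by apply: IHn eq_zy; lia.
Qed.

Lemma aut_letter_perm :
  exists s : 'S_Delta.+1, forall x, word (p x) = map s (word x).
Proof.
have rep a : exists x, head ord0 (word x) == a.
  have [||x [t ex]] := @word_cat_ex [:: a]; rewrite //=; first by lia.
  by exists x; rewrite ex.
(* By [aut_head], the choice of a vertex starting with [a] is immaterial. *)
pose f a := head ord0 (word (p (xchoose (rep a)))).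
have fE x : head ord0 (word (p x)) = f (head ord0 (word x)).
  by apply: aut_head; rewrite (eqP (xchooseP (rep _))).
have word_f x : word (p x) = map f (word x).
  apply: (@eq_from_nth _ ord0); rewrite ?size_map !size_word // => i lt_iD.
  rewrite (nth_map ord0) ?size_word //.
  have [z ez] := word_rot_ex i x.
  have := fE z; rewrite ez (aut_rot ez) -!nth0 /rot.
  by rewrite !nth_cat !size_drop !size_word subn_gt0 lt_iD !nth_drop addn0.
(* As D >= 2, two distinct letters occur in a common vertex, whose image has distinct letters. *)
have f_inj : injective f.
  move=> a b; apply: contra_eq => ne_ab.
  have [||x [t ex]] := @word_cat_ex [:: a; b].
  - by rewrite /= inE ne_ab.
  - by rewrite /=; lia.
  have := uniq_word (p x); rewrite word_f ex /= inE negb_or.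
  by case/andP=> /andP[].
by exists (perm f_inj) => x; rewrite word_f; apply: eq_map => a; rewrite permE.
Qed.

End Automorphism.

(** * The symmetric group acting letterwise *)

Lemma letter_action_ex (s : 'S_Delta.+1) x : {y | word y = map s (word x)}.
Proof.
apply: word_ex; first by rewrite size_map size_word.
by rewrite map_inj_uniq ?uniq_word //; exact: perm_inj.
Qed.

Definition letter_action s x := sval (letter_action_ex s x).

Lemma word_letter_action s x : word (letter_action s x) = map s (word x).
Proof. exact: svalP (letter_action_ex s x). Qed.

Lemma letter_action_inj s : injective (letter_action s).
Proof.
move=> x y /(congr1 word); rewrite !word_letter_action => /inj_map exy.
by apply/word_inj/exy/perm_inj.
Qed.

Definition letter_perm s : {perm vertex} := perm (@letter_action_inj s).

Lemma word_letter_perm s x : word (letter_perm s x) = map s (word x).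
Proof. by rewrite permE word_letter_action. Qed.

Lemma letter_permM :
  {in [set: 'S_Delta.+1] &, {morph letter_perm : s t / (s * t)%g}}.
Proof.
move=> s t _ _; apply/permP => x; apply: word_inj.
rewrite permM !word_letter_perm -map_comp; apply: eq_map => a /=.
by rewrite permM.
Qed.

Canonical letter_perm_morphism := Morphism letter_permM.

Lemma letter_perm_arc s x y :
  arc x y -> arc (letter_perm s x) (letter_perm s y).
Proof.
case/cp_arcP=> m lt_r ey; apply/cp_arcP; exists (s m).
  by rewrite word_letter_perm index_map //; exact: perm_inj.
rewrite !word_letter_perm ey /cp_move /= map_take; congr (_ :: take _ _).
by rewrite !remE index_map ?map_cat ?map_take ?map_drop //; exact: perm_inj.
Qed.

Lemma letter_perm_aut s : letter_perm s \in digraph_aut arc.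
Proof.
apply/digraph_autP => x y; apply/idP/idP; first exact: letter_perm_arc.
move/(letter_perm_arc s^-1%g).
have letter_permK z : letter_perm s^-1%g (letter_perm s z) = z.
  apply: word_inj; rewrite !word_letter_perm -map_comp -[RHS]map_id.
  by apply: eq_map => a /=; rewrite permK.
by rewrite !letter_permK.
Qed.

(** Every letter begins some vertex, so the action on vertices determines the permutation of
    letters. *)
Lemma injm_letter_perm : ('injm letter_perm)%g.
Proof.
apply/injmP => s t _ _ est; apply/permP => a.
have [||x [u ex]] := @word_cat_ex [:: a]; rewrite //=; first by lia.
have := word_letter_perm s x; rewrite est word_letter_perm ex /=.
by case.
Qed.

Lemma im_letter_perm : (letter_perm @* [set: 'S_Delta.+1])%g = digraph_aut arc.
Proof.
apply/setP=> p; apply/idP/idP.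
  by case/morphimP=> s _ _ ->; exact: letter_perm_aut.
move=> /aut_letter_perm[s ps]; apply/morphimP; exists s => //; rewrite ?inE //.
by apply/permP => x; apply: word_inj; rewrite word_letter_perm.
Qed.

End CyclePrefix.

Local Open Scope group_scope.

Theorem theorem2p1 (Delta D r : nat) (hD : (D <= Delta)%N)
    (hr : (r.+2 <= D)%N) :
  digraph_aut (cp_arc Delta D r) \isog [set: 'S_(Delta.+1)].
Proof.
rewrite isog_sym; have := sub_isog (subxx _) (injm_letter_perm hD hr).
by rewrite (im_letter_perm hD hr).
Qed.
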